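(* Let $\chi$ be a finite or countable alphabet and let $\mu,\nu$ be stationary ergodic probability measures on $\chi^{\mathbb{N}}$ with $\mu$ absolutely continuous with respect to $\nu$. If $\mu$ has positive entropy, then: (a) $\displaystyle\liminf_{n\to\infty}\frac{T_n^{(2)}}{n}\ge 1$, $\ \mu\times\nu$-almost everywhere. (b) If, in addition, $\nu$ verifies the very weak specification property (VWSP), then $\displaystyle\lim_{n\to\infty}\frac{T_n^{(2)}}{n}=1$, $\ \mu\times\nu$-almost everywhere.
   Context: Sequences in $\chi^{\mathbb{N}}$ are written $\mathbf{x}=(x_0,x_1,\dots)$, $\sigma$ is the left shift on $\chi^{\mathbb{N}}$, i.e. $\sigma\mathbf{x}=(x_1,x_2,\dots)$, and $x_m^n=x_mx_{m+1}\cdots x_n$. A string $\omega\in\chi^n$ is identified with the cylinder of sequences $\mathbf{z}\in\chi^{\mathbb{N}}$ with $z_0^{n-1}=\omega$. Stationary means $\sigma$-invariant. Entropy means the Shannon entropy of the stationary measure, i.e. for ergodic $\mu$ the $\mu$-almost everywhere limit of $-\frac1n\log\mu(x_0^{n-1})$. The pair $(\mathbf{x},\mathbf{y})$ is distributed according to the product measure $\mu\times\nu$ ($\mathbf{x}$ according to $\mu$, $\mathbf{y}$ according to $\nu$). Shortest-path function: $T_n^{(2)}(\mathbf{x},\mathbf{y})=\inf\{k\ge 1: y_0^{n-1}\cap\sigma^{-k}(x_0^{n-1})\ne\emptyset\}$. Very weak specification property: $(\chi^{\mathbb{N}},\nu,\sigma)$ has the VWSP if there exists a function $g:\mathbb{N}\to\mathbb{N}$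 with $\lim_{n\to\infty}g(n)/n=0$ such that, for any pair of strings $\omega,\xi\in\chi^n$, there exists $\mathbf{x}\in\chi^{\mathbb{N}}$ with $x_0^{n-1}=\omega$ and $x_{n+g(n)}^{2n+g(n)-1}=\xi$. *)

(* Defs.v *)
From HB Require Import structures.
From mathcomp Require Import all_boot all_order all_algebra.
From mathcomp Require Import all_classical all_reals all_analysis.

Set Implicit Arguments.
Unset Strict Implicit.
Unset Printing Implicit Defensive.

Import Order.TTheory GRing.Theory Num.Theory.
Import numFieldNormedType.Exports.

Local Open Scope classical_set_scope.
Local Open Scope ring_scope.
Local Open Scope ereal_scope.

Section sequences_over_an_alphabet.
Variable chi : pointedType.

(* [block x m n] is the string x_m ... x_{m+n-1} of length n. *)
Definition block (x : nat -> chi) (m n : nat) : n.-tuple chi :=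
  [tuple x (m + i)%N | i < n].

Definition cylinder (n : nat) (w : n.-tuple chi) : set (nat -> chi) :=
  [set z | block z 0 n = w].

Definition cylinders : set (set (nat -> chi)) :=
  [set A | exists n (w : n.-tuple chi), A = cylinder w].

(* chi^N with the sigma-algebra generated by the cylinders; for a countable
   alphabet it is the product of the discrete sigma-algebras. *)
Definition seqspace := g_sigma_algebraType cylinders.

HB.instance Definition _ := Measurable.on seqspace.

Definition shift (x : nat -> chi) : nat -> chi := fun n => x n.+1.

End sequences_over_an_alphabet.

Section measures.
Variables (R : realType) (chi : pointedType).
Implicit Types (mu nu : probability (seqspace chi) R) (X : set (seqspace chi)).

Definition stationary mu : Prop :=
  forall A : set (seqspace chi), measurable A ->
    mu (@shift chi @^-1` A) = mu A.

Definition ergodic mu : Prop :=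
  forall A : set (seqspace chi), measurable A ->
    @shift chi @^-1` A = A -> mu A = 0 \/ mu A = 1.

(* Entropy is the almost sure limit of the normalized information, and may be
   infinite when the alphabet is infinite. *)
Definition has_entropy mu (h : \bar R) : Prop :=
  {ae mu, forall x : seqspace chi,
    (n%:R^-1)%:E * - lne (mu (cylinder (block x 0 n))) @[n --> \oo] --> h}.

Definition positive_entropy mu : Prop :=
  exists2 h : \bar R, 0 < h & has_entropy mu h.

(* The topological support of mu (for the discrete topology on chi). *)
Definition support_of mu : set (seqspace chi) :=
  [set z | forall n, 0 < mu (cylinder (block z 0 n))].

(* [X] is the set of sequences among which paths are taken. With X = setT the
   two definitions below concern all of chi^N (and then [vwsp] is always true);
   with X = support_of nu they concern the paths allowed by nu. *)

(* The infimum is +oo when no path of X joins the two strings. *)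
Definition shortest_path X (n : nat) (x y : nat -> chi) : \bar R :=
  ereal_inf [set k%:R%:E | k in [set k : nat | (1 <= k)%N /\
    X `&` (cylinder (block y 0 n) `&`
           iter k (@shift chi) @^-1` cylinder (block x 0 n)) !=set0]].

Definition occurs_in X (n : nat) (w : n.-tuple chi) : Prop :=
  X `&` cylinder w !=set0.

Definition vwsp X : Prop :=
  exists g : nat -> nat,
    ((g n)%:R / n%:R : R)%R @[n --> \oo] --> (0 : R)%R /\
    forall (n : nat) (w xi : n.-tuple chi), occurs_in X w -> occurs_in X xi ->
      exists x : nat -> chi,
        [/\ X x, block x 0 n = w & block x (n + g n) n = xi].

End measures.
Arguments vwsp R {chi} X.
Arguments shortest_path R {chi} X n x y.

(* Main.v *)
Require Import Defs.
From mathcomp Require Import all_boot all_order all_algebra.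
From mathcomp Require Import all_classical all_reals all_analysis.
From mathcomp Require Import zify.
Import Order.TTheory GRing.Theory Num.Theory.
Import numFieldNormedType.Exports.
Local Open Scope classical_set_scope.
Local Open Scope ring_scope.
Local Open Scope ereal_scope.

(* A path of length k < n from y to x forces the overlap
   x_0 ... x_(n-k-1) = y_k ... y_(n-1).  By Fubini, the probability that a string
   of length m read in y is the prefix of x and has mu-measure at most e^(-cm) is
   at most e^(-cm).  Positive entropy gives c > 0 such that almost every x has
   mu(x_0 ... x_(m-1)) <= e^(-cm) for m large.  Summing over the k with
   n - k >= n/p, the overlaps at stage n have probability at most n e^(-cn/p),
   so by Borel-Cantelli almost surely T_n >= (1 - 1/p) n eventually, for every p.
   For the upper bound, almost every y is in the support of nu, and so is almost
   every x since mu << nu; the specification property then gives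
   T_n <= n + g(n). *)

(** * Strings read in sequences *)

Lemma block_eqP (chi : pointedType) (x y : nat -> chi) (m n l : nat) :
  block x m l = block y n l <->
  forall i, (i < l)%N -> x (m + i)%N = y (n + i)%N.
Proof.
split=> [xy i il|xy].
  have := congr1 (fun w => tnth w (Ordinal il)) xy.
  by rewrite !tnth_mktuple.
by apply: eq_from_tnth => i; rewrite !tnth_mktuple xy.
Qed.

Lemma iter_shiftE (chi : pointedType) (x : nat -> chi) (k i : nat) :
  iter k (@Defs.shift chi) x i = x (k + i)%N.
Proof. by elim: k i => [//|k IH] i; rewrite iterS /Defs.shift IH addnS addSn. Qed.

Lemma countable_tuple (chi : pointedType) (n : nat) :
  countable [set: chi] -> countable [set: n.-tuple chi].
Proof.
move=> /countable_injP[f finj]; apply/countable_injP.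
exists (fun w : n.-tuple chi => pickle (map f w)) => v w _ _.
move=> /(pcan_inj pickleK)/inj_map vw; apply/val_inj/vw => a b.
by apply: finj; rewrite inE.
Qed.

(** * Events about strings: measurability, Fubini bound, support *)

Section probabilities.
Variables (R : realType) (chi : pointedType).
Hypothesis countable_chi : countable [set: chi].
Implicit Types (mu nu : probability (seqspace chi) R).

Lemma measurable_cylinder (n : nat) (w : n.-tuple chi) :
  measurable (cylinder w : set (seqspace chi)).
Proof. by apply: sub_sigma_algebra; exists n, w. Qed.

(** There are countably many strings, so any predicate [P] on prefixes cuts out a countable union of
    cylinders. *)
Lemma measurable_prefix (n : nat) (P : set (n.-tuple chi)) :
  measurable [set x : seqspace chi | P (block x 0 n)].
Proof.
rewrite [X in measurable X](_ : _ = \bigcup_(w : n.-tuple chi)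
    (if `[< P w >] then cylinder w else set0 : set (seqspace chi))).
  apply: countable_bigcupT_measurable; first exact: countable_tuple.
  by move=> w; case: (asboolP (P w)) => _; [exact: measurable_cylinder|exact: measurable0].
apply/seteqP; split=> [x Px|x [w _]].
  by exists (block x 0 n) => //; case: asboolP.
by case: asboolP => // Pw; rewrite /cylinder/= => ->.
Qed.

(** The string at position [k] is the end of the prefix of length [k + m]. *)
Lemma measurable_block (k m : nat) (w : m.-tuple chi) :
  measurable [set x : seqspace chi | block x k m = w].
Proof.
have := @measurable_prefix (k + m)
  [set v | [tuple tnth v (rshift k i) | i < m] = w].
congr (measurable _); apply/funext => x /=; congr (_ = _).
by apply: eq_from_tnth => i; rewrite !tnth_mktuple.
Qed.

(** The event is a countable union of rectangles, one for each common string [w]. *)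
Lemma measurable_match (k m : nat) (P : set (m.-tuple chi)) :
  measurable [set xy : seqspace chi * seqspace chi |
    P (block xy.1 0 m) /\ block xy.1 0 m = block xy.2 k m].
Proof.
rewrite [X in measurable X](_ : _ = \bigcup_(w : m.-tuple chi)
    ([set x : seqspace chi | P w /\ block x 0 m = w] `*`
     [set y : seqspace chi | block y k m = w])).
  apply: countable_bigcupT_measurable; first exact: countable_tuple.
  move=> w; apply: measurableX; last exact: measurable_block.
  exact: (@measurable_prefix m (fun v => P w /\ v = w)).
apply/seteqP; split=> [[x y] /= [Px xy]|[x y] [w _ /= [[Pw xw] yw]]].
  by exists (block x 0 m).
by rewrite xw yw.
Qed.

(** Fix [y]: the matching [x] lie in the cylinder of the string that [y] shows at position [k], of
    measure at most [q] whenever the section is nonempty. Then integrate over [y]. *)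
Lemma match_probability_le mu nu (k m : nat) (q : R) : (0 <= q)%R ->
  (mu \x nu) [set xy : seqspace chi * seqspace chi |
    mu (cylinder (block xy.1 0 m)) <= q%:E /\
    block xy.1 0 m = block xy.2 k m] <= q%:E.
Proof.
move=> q0; set E := [set _ | _].
have mE : measurable E.
  exact: (@measurable_match k m (fun w => mu (cylinder w) <= q%:E)).
(* The product measure is rewritten as the integral over [y] of the measures of the sections in
   [x]. *)
rewrite (@product_measure_unique _ _ _ _ _ mu nu (mu \x^ nu))//; last first.
  by move=> A B mA mB; exact: product_measure2E.
rewrite /product_measure2 -[leRHS]mule1 -(@probability_setT _ _ _ nu).
rewrite -integral_cst//; apply: ge0_le_integral => //=.
- exact: measurable_fun_ysection.
- move=> y _; have [yq|yq] := leP (mu (cylinder (block y k m))) q%:E.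
    apply: le_trans yq; apply: le_measure; rewrite ?inE//.
    + exact: measurable_ysection.
    + exact: measurable_cylinder.
    + by move=> x /ysectionP[_].
  rewrite (_ : ysection E y = set0) ?measure0 ?lee_fin//.
  apply/seteqP; split=> // x /ysectionP[/= + xy].
  by rewrite xy leNgt yq.
Qed.

Lemma ae_fst mu nu (P : set (seqspace chi)) :
  {ae mu, forall x, P x} ->
  {ae mu \x nu, forall xy : seqspace chi * seqspace chi, P xy.1}.
Proof.
move=> [N [mN N0 PN]]; exists (N `*` setT); split.
- exact: measurableX.
- have -> : (mu \x nu) (N `*` setT) = mu N * nu setT by exact: product_measure1E.
  by rewrite N0 mul0e.
- by move=> xy Pxy; split=> //; exact: PN.
Qed.

Lemma ae_snd mu nu (P : set (seqspace chi)) :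
  {ae nu, forall y, P y} ->
  {ae mu \x nu, forall xy : seqspace chi * seqspace chi, P xy.2}.
Proof.
move=> [N [mN N0 PN]]; exists (setT `*` N); split.
- exact: measurableX.
- have -> : (mu \x nu) (setT `*` N) = mu setT * nu N by exact: product_measure1E.
  by rewrite N0 mule0.
- by move=> xy Pxy; split=> //; exact: PN.
Qed.

(** Outside the support some prefix has a null cylinder. With [f] numbering the strings of length
    [n], each [F k] is empty or inside one null cylinder. *)
Lemma support_ae nu : {ae nu, forall y, support_of nu y}.
Proof.
apply: ae_foralln => n.
have /countable_injP[f finj] := countable_tuple _ n countable_chi.
pose F k := [set y : seqspace chi |
  ~ 0 < nu (cylinder (block y 0 n)) /\ f (block y 0 n) = k].
apply: (@negligibleS _ _ _ _ (\bigcup_k F k)).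
  by move=> y /= y0; exists (f (block y 0 n)).
apply: negligible_bigcup => k.
have [->|/set0P[y [y0 yk]]] := eqVneq (F k) set0; first exact: negligible_set0.
exists (cylinder (block y 0 n)); split; first exact: measurable_cylinder.
  by apply/eqP; rewrite -measure_le0 leNgt; exact/negP.
by move=> z [_ zk]; apply: finj; rewrite ?inE// zk yk.
Qed.

End probabilities.

(** * Lower limits and a summability criterion *)

Lemma limn_einf_ge (R : realType) (u : (\bar R)^nat) (a : \bar R) :
  (\forall n \near \oo, a <= u n) -> a <= limn_einf u.
Proof.
move=> [N _ au]; rewrite limn_einf_lim; apply: lime_ge; first exact: is_cvg_einfs.
near=> n; apply: le_ereal_inf_tmp => _ [m /= nm <-]; apply: au => /=.
by apply: leq_trans nm; near: n; exists N.
Unshelve. all: by end_near. Qed.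

(** The tail infima of [u] lie below [u], hence eventually below [v]. Their limit is therefore at
    most [l], so it equals [l] and [u] is squeezed. *)
Lemma squeeze_limn_einf (R : realType) (u v : (\bar R)^nat) (l : \bar R) :
  l <= limn_einf u -> (\forall n \near \oo, u n <= v n) ->
  v @ \oo --> l -> u @ \oo --> l.
Proof.
move=> lu uv vl.
have eu n : einfs u n <= u n by apply: ereal_inf_lbound; exists n => /=.
have ev : \forall n \near \oo, einfs u n <= v n.
  by apply: filterS uv => n; exact: le_trans.
have ul : limn_einf u = l.
  apply/eqP; rewrite eq_le lu andbT limn_einf_lim -(cvg_lim _ vl)//.
  by apply: lee_lim => //; [exact: is_cvg_einfs|exact: cvgP vl].
apply: (squeeze_cvge (f := einfs u) _ _ vl).
  by apply: filterS uv => n uvn; rewrite eu.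
by rewrite -ul limn_einf_lim; exact: is_cvg_einfs.
Qed.

Lemma nneseries_lty_geometric (R : realType) (f : (\bar R)^nat) (K z : R) :
  (0 <= K)%R -> (0 < z < 1)%R ->
  (forall n, 0 <= f n <= (K * z ^+ n)%:E) -> \sum_(0 <= n <oo) f n < +oo.
Proof.
move=> K0 /andP[z0 z1] f_le.
apply: (@le_lt_trans _ _ (K * (1 - z)^-1)%:E); last exact: ltry.
apply: lime_le.
  by apply: is_cvg_nneseries => n _ _; have /andP[] := f_le n.
apply: nearW => n; apply: (@le_trans _ _ (series (geometric K z) n)%:E).
  rewrite /series/= -sumEFin; apply: lee_sum => i _.
  by have /andP[] := f_le i.
by rewrite lee_fin geometric_le_lim// gtr0_norm.
Qed.

(** Half of the exponent absorbs the factor [n], as [b n <= 1 + b n <= e^(b n)]; the other half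
    leaves a geometric term. *)
Lemma mulrn_expR_le (R : realType) (b : R) (n : nat) : (0 < b)%R ->
  (n%:R * expR (- (b + b) * n%:R) <= b^-1 * expR (- b) ^+ n)%R.
Proof.
move=> b0; rewrite -expRM_natr opprD mulrDl expRD mulrA.
rewrite ler_wpM2r ?expR_ge0// -ler_pdivlMr ?expR_gt0// -expRN mulNr opprK.
rewrite -ler_pdivrMl ?invr_gt0// invrK.
by apply: le_trans (expR_ge1Dx _); rewrite lerDr.
Qed.

(** * Exponential decay of cylinders under positive entropy *)

Lemma positive_entropy_cylinder_le (R : realType) (chi : pointedType)
    (mu : probability (seqspace chi) R) :
  positive_entropy mu ->
  exists2 c : R, (0 < c)%R &
  {ae mu, forall x : seqspace chi, \forall m \near \oo,
    mu (cylinder (block x 0 m)) <= (expR (- c * m%:R))%:E}.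
Proof.
move=> [h h0 hmu].
(* Any rate strictly below [h] works; [h] may be infinite. *)
have [c c0 ch] : exists2 c : R, (0 < c)%R & c%:E < h.
  case: h h0 {hmu} => [r| |]//.
    rewrite lte_fin => r0; exists (r / 2)%R; first by rewrite divr_gt0.
    by rewrite lte_fin ltr_pdivrMr// ltr_pMr// ltr1n.
  by exists 1%R => //; rewrite ltry.
exists c => //; apply: filterS hmu => x.
move=> /(_ _ (open_ereal_gt' ch)); rewrite near_simpl/= => cx.
near=> m.
have m0 : (0 < m)%N by near: m; exists 1%N.
have : c%:E < (m%:R^-1)%:E * - lne (mu (cylinder (block x 0 m))) by near: m; exact: cx.
have : mu (cylinder (block x 0 m)) \is a fin_num.
  by apply: fin_num_measure; exact: measurable_cylinder.
case: (mu _) => // r _ /=.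
(* [lne] is defined by cases on [r <= 0]; there the bound is immediate. *)
case: ifPn => [r0 _|]; first by rewrite lee_fin (le_trans r0)// expR_ge0.
rewrite -ltNge -EFinN -EFinM lte_fin lee_fin => r0.
rewrite ltr_pdivlMl ?ltr0n// => cr.
rewrite -[leLHS]lnK// ler_expR mulNr lerNr mulrC ltW//.
Unshelve. all: by end_near. Qed.

(** * Long overlaps and Borel-Cantelli *)

Section overlaps.
Variables (R : realType) (chi : pointedType).
Implicit Types (mu nu : probability (seqspace chi) R).

(** The smallness of the cylinder is part of the event, so that its probability is bounded for every
    [m], not only for large [m] depending on [x]. *)
Definition string_match mu (c : R) (k m : nat) :
    set (seqspace chi * seqspace chi) :=
  [set xy | mu (cylinder (block xy.1 0 m)) <= (expR (- c * m%:R))%:E /\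
            block xy.1 0 m = block xy.2 k m].

(* [n <= p * (n - k)] stands for [k <= (1 - 1/p) n]. *)
Definition overlap mu (c : R) (p n : nat) : set (seqspace chi * seqspace chi) :=
  \big[setU/set0]_(k < n)
    if (n <= p * (n - k))%N then string_match mu c k (n - k) else set0.

Lemma string_match_overlap mu (c : R) (p n k : nat)
    (xy : seqspace chi * seqspace chi) :
  (k < n)%N -> (n <= p * (n - k))%N ->
  string_match mu c k (n - k) xy -> overlap mu c p n xy.
Proof.
move=> kn npk xyk; rewrite /overlap -(bigcup_mkord n (fun k =>
  if (n <= p * (n - k))%N then string_match mu c k (n - k) else set0)).
by exists k => //=; rewrite npk.
Qed.

Hypothesis countable_chi : countable [set: chi].

Let measurable_overlap_term mu (c : R) (p n k : nat) :
  measurable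
    (if (n <= p * (n - k))%N then string_match mu c k (n - k) else set0).
Proof.
case: ifP => _ //; exact: (@measurable_match _ countable_chi k (n - k)
  (fun w => mu (cylinder w) <= (expR (- c * (n - k)%:R))%:E)).
Qed.

Lemma measurable_overlap mu (c : R) (p n : nat) : measurable (overlap mu c p n).
Proof. by apply: bigsetU_measurable => k _; exact: measurable_overlap_term. Qed.

Lemma overlap_probability_le mu nu (c : R) (p n : nat) : (0 < c)%R -> (0 < p)%N ->
  (mu \x nu) (overlap mu c p n) <= (n%:R * expR (- (c / p%:R) * n%:R))%:E.
Proof.
move=> c0 p0.
apply: (le_trans (@content_subadditive _ _ _ (mu \x nu) _
    (fun k => if (n <= p * (n - k))%N then string_match mu c k (n - k) else set0)
    n _ (measurable_overlap mu c p n) (@subset_refl _ _))).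
  by move=> k _; exact: measurable_overlap_term.
apply: (@le_trans _ _ (\sum_(k < n) (expR (- (c / p%:R) * n%:R))%:E)).
  apply: lee_sum => k _; case: ifPn => [npk|_].
    apply: (le_trans (@match_probability_le _ _ countable_chi _ _ _ _ _ _)).
      exact: expR_ge0.
    (* From [n <= p (n - k)] follows [(c / p) n <= c (n - k)]. *)
    rewrite lee_fin ler_expR !mulNr lerN2 -mulrA ler_pM2l//.
    by rewrite ler_pdivrMl ?ltr0n// -natrM ler_nat.
  by rewrite measure0 lee_fin expR_ge0.
by rewrite sumEFin sumr_const card_ord lee_fin mulr_natl.
Qed.

Lemma overlap_ae mu nu (c : R) (p : nat) :
  (0 < c)%R -> (0 < p)%N ->
  {ae mu \x nu, forall xy, \forall n \near \oo, ~ overlap mu c p n xy}.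
Proof.
move=> c0 p0.
exists (lim_sup_set (overlap mu c p)); split.
- apply: bigcapT_measurable => n; apply: bigcup_measurable => k _.
  exact: measurable_overlap.
- apply: lim_sup_set_cvg0; first by move=> n; exact: measurable_overlap.
  (* Half the decay rate, the other half being spent on the factor [n]. *)
  pose b := (c / p%:R / 2)%R.
  have b0 : (0 < b)%R by rewrite !divr_gt0// ltr0n.
  have bb : (c / p%:R = b + b)%R by rewrite /b -splitr.
  apply: (@nneseries_lty_geometric _ _ b^-1 (expR (- b))).
  + by rewrite invr_ge0 ltW.
  + by rewrite expR_gt0 expR_lt1 oppr_lt0.
  + move=> n; rewrite measure_ge0/=; apply: le_trans.
      exact: overlap_probability_le.
    by rewrite bb lee_fin mulrn_expR_le.
- move=> xy nxy n _; apply: contrapT => nov; apply: nxy.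
  by exists n => // m /= nm om; apply: nov; exists m.
Qed.

End overlaps.

(** * Deterministic bounds on the shortest path *)

Lemma shortest_path_ge (R : realType) (chi : pointedType)
    (X : set (seqspace chi)) (p n : nat) (x y : nat -> chi) :
  (0 < p)%N ->
  (forall k, (k < n)%N -> (n <= p * (n - k))%N ->
    block x 0 (n - k) <> block y k (n - k)) ->
  ((1 - p%:R^-1) * n%:R)%:E <= shortest_path R X n x y.
Proof.
move=> p0 xy; apply: le_ereal_inf_tmp => _ [k [_ [z [_ [zy zx]]]] <-].
rewrite lee_fin mulrBl mul1r lerBlDl -lerBlDr.
have [nk|kn] := leqP n k.
  by rewrite (@le_trans _ _ 0%R)// ?subr_le0 ?ler_nat// mulr_ge0.
(* A path [z] of length [k < n] carries [y] on positions below [n] and [x] from position [k] on, so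
   both agree on the [n - k] shared positions. *)
rewrite ler_pdivlMl ?ltr0n// -natrB ?(ltnW kn)// -natrM ler_nat ltnW// ltnNge.
apply/negP => npk; apply: (xy k kn npk); apply/block_eqP => i ink.
move/block_eqP: zx => /(_ i) <-; last by lia.
by move/block_eqP: zy => /(_ (k + i)%N) <-; [rewrite iter_shiftE|lia].
Qed.

Lemma shortest_path_le (R : realType) (chi : pointedType)
    (X : set (seqspace chi)) (n g : nat) (x y z : nat -> chi) :
  (0 < n)%N -> X z -> block z 0 n = block y 0 n ->
  block z (n + g) n = block x 0 n ->
  shortest_path R X n x y <= (n + g)%:R%:E.
Proof.
move=> n0 Xz zy zx; apply: ereal_inf_lbound; exists (n + g)%N => //; split.
  by rewrite (leq_trans n0)// leq_addr.
exists z; split=> //; split=> //.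
apply/block_eqP => i il; rewrite iter_shiftE add0n.
by move/block_eqP: zx => ->.
Qed.

Theorem theorem3p1 (R : realType) (chi : pointedType)
    (countable_chi : countable [set: chi])
    (mu nu : probability (seqspace chi) R)
    (stationary_mu : stationary mu) (ergodic_mu : ergodic mu)
    (stationary_nu : stationary nu) (ergodic_nu : ergodic nu)
    (mu_ac_nu : mu `<< nu)
    (entropy_mu : positive_entropy mu)
    (X : set (seqspace chi)) (supp_nu_X : support_of nu `<=` X) :
  {ae mu \x nu, forall xy : seqspace chi * seqspace chi,
    1 <= limn_einf (fun n : nat =>
      (n%:R^-1)%:E * shortest_path R X n xy.1 xy.2)} /\
  (vwsp R X ->
   {ae mu \x nu, forall xy : seqspace chi * seqspace chi,
     (n%:R^-1)%:E * shortest_path R X n xy.1 xy.2 @[n --> \oo] --> 1}).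
Proof.
have liminf_ge1 : {ae mu \x nu, forall xy : seqspace chi * seqspace chi,
    1 <= limn_einf (fun n : nat =>
      (n%:R^-1)%:E * shortest_path R X n xy.1 xy.2)}.
  have [c c0 cyl_le] := positive_entropy_cylinder_le _ _ _ entropy_mu.
  (* Countably many [p] share one null set; [p.+1] keeps the denominator positive. *)
  have no_overlap : {ae mu \x nu, forall xy, forall p : nat,
      \forall n \near \oo, ~ overlap R chi mu c p.+1 n xy}.
    by apply: ae_foralln => p; exact: overlap_ae.
  apply: filterS2 (ae_fst _ _ mu nu _ cyl_le) no_overlap => -[x y] /= [N _ xN] xy.
  apply/lee_subgt0Pr => e e0.
  have [p pe] : exists p : nat, (p.+1%:R^-1 < e)%R.
    exists (Num.truncn e^-1).
    by rewrite invf_plt ?posrE// truncnS_gt.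
  apply: limn_einf_ge; near=> n.
  have n0 : (0 < n)%N by near: n; exists 1%N.
  rewrite -EFinB lee_pdivlMl ?ltr0n// -EFinM.
  apply: (@le_trans _ _ ((1 - p.+1%:R^-1) * n%:R)%:E).
    by rewrite lee_fin mulrC ler_wpM2r// lerD2l lerN2 ltW.
  apply: shortest_path_ge => // k kn npk xyk.
  have : ~ overlap R chi mu c p.+1 n (x, y) by near: n; exact: xy.
  apply; apply: (string_match_overlap _ _ _ _ _ _ _ _ kn npk).
  split=> //; apply: xN => /=.
  (* Together with [n <= p.+1 * (n - k)] this gives [N <= n - k], so the overlap is long enough for
     the entropy bound on cylinders. *)
  have : (p.+1 * N <= n)%N by near: n; exists (p.+1 * N)%N.
  by move=> /leq_trans/(_ npk); rewrite leq_pmul2l.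
split=> // -[g [g0 pathP]].
(* Absolute continuity carries the [nu]-null complement of the support to a [mu]-null set. *)
have mu_supp : {ae mu, forall x, support_of nu x}.
  have [N [mN N0 suppN]] := support_ae _ _ countable_chi nu.
  by exists N; split=> //; move/null_content_dominatesP: mu_ac_nu; apply.
apply: filterS3 liminf_ge1 (ae_fst _ _ mu nu _ mu_supp)
  (ae_snd _ _ mu nu _ (support_ae _ _ countable_chi nu)) => -[x y] /= ge1 xs ys.
(* The upper sequence is [(n + g n) / n], from a path of length [n + g n] starting with the prefix
   of [y] and reaching that of [x]. *)
apply: (@squeeze_limn_einf _ _ (fun n => (1 + (g n)%:R / n%:R)%:E)) => //.
  near=> n.
  have n0 : (0 < n)%N by near: n; exists 1%N.
  have [z [Xz zy zx]] : exists z, [/\ X z, block z 0 n = block y 0 n &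
      block z (n + g n) n = block x 0 n].
    by apply: pathP; [exists y|exists x]; split=> //; exact: supp_nu_X.
  rewrite lee_pdivrMl ?ltr0n//; apply: le_trans.
    exact: shortest_path_le zx.
  by rewrite -EFinM mulrDr mulr1 mulrC divfK ?pnatr_eq0 ?lt0n_neq0// natrD.
apply: cvg_EFin; first exact: nearW.
rewrite -[X in _ --> X]addr0.
by apply: cvgD => //; exact: cvg_cst.
Unshelve. all: by end_near. Qed.
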